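(* A graph $G$ is omnitonal if and only if, for every integer $r$ with $0\le r\le e(G)$, $G$ has both a partition $V(G)=X\cup Y$ and a set of vertices $W\subseteq V(G)$ such that $e(X,Y)=e(G[W])=r$.
   Context: Graphs are finite and simple; $e(G)=|E(G)|$; for a partition $V(G)=X\cup Y$ (disjoint parts, possibly empty), $e(X,Y)$ is the number of edges with one end in $X$ and the other in $Y$; $G[W]$ is the subgraph induced by $W$ ($W$ may be empty). A $2$-coloring $E(K_n)=E(R)\cup E(B)$ is a partition of the edges of $K_n$ into red edges (forming $R$) and blue edges (forming $B$). An $(r,b)$-colored copy of $G$ (with $r+b=e(G)$) is a (not necessarily induced) subgraph of $K_n$ isomorphic to $G$ with exactly $r$ red and $b$ blue edges. ${\rm ot}(n,G)$ is the minimum non-negative integer $s$ such that every $2$-coloring $E(K_n)=E(R)\cup E(B)$ with $\min\{e(R),e(B)\}>s$ contains an $(r,b)$-colored copy of $G$ for every pair of integers $r,b\ge0$ with $r+b=e(G)$. The graph $G$ is omnitonal if for every sufficiently large $n$ such an integer exists non-vacuously, that is, ${\rm ot}(n,G)<\lfloor\frac12\binom n2\rfloor$ (so that there are colorings with $\min\{e(R),e(B)\}>{\rm ot}(n,G)$). *)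

(* Defs.v *)
From mathcomp Require Import all_boot.

Set Implicit Arguments.
Unset Strict Implicit.
Unset Printing Implicit Defensive.

Record sgraph := SGraph {
  vertex :> finType;
  edges : {set {set vertex}};
  edges_card2 : forall e : {set vertex}, e \in edges -> #|e| = 2
}.

Definition num_edges (G : sgraph) : nat := #|edges G|.

Definition cut_edges (G : sgraph) (X Y : {set G}) : {set {set G}} :=
  [set e in edges G | [exists x in X, exists y in Y, e == [set x; y]]].

Definition induced_edges (G : sgraph) (W : {set G}) : {set {set G}} :=
  [set e in edges G | e \subset W].

(* [partition] from finset is not used: it forbids empty parts. *)
Definition bipartition (T : finType) (S A B : {set T}) : bool :=
  (A :|: B == S) && [disjoint A & B].

Definition complete_edges (n : nat) : {set {set 'I_n}} :=
  [set e : {set 'I_n} | #|e| == 2].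

Lemma complete_edges_card2 n (e : {set 'I_n}) :
  e \in complete_edges n -> #|e| = 2.
Proof. by rewrite inE => /eqP. Qed.

Definition complete_graph (n : nat) : sgraph :=
  SGraph (@complete_edges_card2 n).

Definition is_subgraph (H : sgraph) (U : {set H}) (F : {set {set H}}) : bool :=
  (F \subset edges H) && [forall e in F, e \subset U].

(* The graph with vertex set [U] and edge set [F] is isomorphic to [G]. *)
Definition isomorphic_to (G : sgraph) (T : finType)
    (U : {set T}) (F : {set {set T}}) : bool :=
  [exists phi : {ffun G -> T},
    [&& injectiveb phi,
        phi @: [set: G] == U
      & [set phi @: (e : {set G}) | e in edges G] == F]].

Definition two_coloring (n : nat) (R B : {set {set 'I_n}}) : bool :=
  bipartition (edges (complete_graph n)) R B.

Definition has_colored_copy (G : sgraph) (n : nat) (R B : {set {set 'I_n}})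
    (r b : nat) : bool :=
  [exists U : {set 'I_n}, exists F : {set {set 'I_n}},
    [&& @is_subgraph (complete_graph n) U F,
        isomorphic_to G U F,
        #|F :&: R| == r
      & #|F :&: B| == b]].

(* The ordinal bounds on [r] and [b] are implied by [r + b = num_edges G];
   they only make the quantifiers finite. *)
Definition ot_admissible (n : nat) (G : sgraph) (s : nat) : bool :=
  [forall R : {set {set 'I_n}}, forall B : {set {set 'I_n}},
    two_coloring R B ==> (s < minn #|R| #|B|) ==>
    [forall r : 'I_(num_edges G).+1, forall b : 'I_(num_edges G).+1,
      (r + b == num_edges G) ==> has_colored_copy G R B r b]].

Lemma ot_admissible_ex n G : exists s, ot_admissible n G s.
Proof.
exists #|{set 'I_n}|; apply/forallP => R; apply/forallP => B.
by apply/implyP => _; rewrite leq_min ltnNge max_card.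
Qed.

Definition ot (n : nat) (G : sgraph) : nat := ex_minn (ot_admissible_ex n G).

Definition omnitonal (G : sgraph) : Prop :=
  exists N : nat, forall n : nat, N <= n -> ot n G < 'C(n, 2)./2.

(* Main.v *)
Require Import Defs.
From mathcomp Require Import all_boot zify.

Set Implicit Arguments.
Unset Strict Implicit.
Unset Printing Implicit Defensive.

(* Necessity: for infinitely many [n] there are colorings of [K_n] with exactly half of the
   edges red in which the red graph is a clique, or a complete bipartite graph; the red edges
   of a copy of [G] are then those induced by a vertex set, respectively those of a cut.

   Sufficiency: let both colors be dense and [m] be large.  If there are both a red and a blue
   [K_m], then bipartite Ramsey between them yields large sets [A], [C] such that one color
   consists exactly of the edges inside [A].  If, say, there is no blue [K_m], then density
   gives a blue [K_{s,s}] (Kovari-Sos-Turan), and Ramsey inside each side gives large red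
   cliques joined completely in blue.  Embedding [G] across the two sets according to [W] or
   to [(X, Y)] gives every color split. *)

(** * Ramsey-type and density results for relations on a finite type *)

Section Ramsey.
Variable T : finType.
Implicit Types (A B P Q S : {set T}) (e r b : rel T).

Definition clique e A := {in A &, forall x y, x != y -> e x y}.

Definition joined e A B := {in A & B, forall x y, e x y}.

Lemma sum_degreesC e P Q :
  \sum_(p in P) #|[set q in Q | e p q]| = \sum_(q in Q) #|[set p in P | e p q]|.
Proof.
under eq_bigr => p _ do rewrite -sum1dep_card.
under [RHS]eq_bigr => q _ do rewrite -sum1dep_card.
rewrite (exchange_big_dep (mem Q)) //= => [|p q _ /andP[]//].
by apply: eq_bigr => q qQ; apply: eq_bigl => p; rewrite qQ.
Qed.

Lemma clique_setU1 e A x :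
  symmetric e -> clique e A -> {in A, forall y, e x y} -> clique e (x |: A).
Proof.
move=> sym_e cliA exA y z /setU1P[->|yA] /setU1P[->|zA]; first by rewrite eqxx.
- by move=> _; exact: exA.
- by move=> _; rewrite sym_e; exact: exA.
- exact: cliA.
Qed.

Lemma sub_clique e A B : A \subset B -> clique e B -> clique e A.
Proof. by move=> /subsetP sAB cliB x y /sAB xB /sAB yB; exact: cliB. Qed.

Lemma sub_joined e A B A' B' :
  A' \subset A -> B' \subset B -> joined e A B -> joined e A' B'.
Proof. by move=> /subsetP sA /subsetP sB jAB x y /sA xA /sB yB; exact: jAB. Qed.

Lemma subset_of_card A k :
  k <= #|A| -> exists2 S : {set T}, S \subset A & #|S| = k.
Proof.
move=> kA; have: 0 < #|[set S : {set T} | S \subset A & #|S| == k]|.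
  by rewrite cards_draws bin_gt0.
by case/card_gt0P => S; rewrite inE => /andP[sSA /eqP cS]; exists S.
Qed.

(** The Kovari-Sos-Turan argument, carried out greedily: some [p] in [P] is related to at least a
    fraction [1 / c] of [Q]; put [p] into [S], delete it from [P], keep only its neighbours in [Q]
    and recurse. Every vertex kept loses one neighbour, so [d] and [s] both drop by one and
    [c * (d - s)] is unchanged. *)
Lemma common_neighbours e c s d P Q :
    s <= #|P| -> #|P| <= c * (d - s) ->
    {in Q, forall q, d <= #|[set p in P | e p q]|} ->
  exists S Q', [/\ S \subset P, Q' \subset Q, #|S| = s,
                   #|Q| <= c ^ s * #|Q'| & joined e S Q'].
Proof.
elim: s d P Q => [|s IHs] d P Q sP Pcd degQ.
  exists set0, Q; split; rewrite ?sub0set ?cards0 ?mul1n //.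
  by move=> x y; rewrite inE.
have [/exists_inP[p pP Qp] | no_p] :=
  boolP [exists p in P, #|Q| <= c * #|[set q in Q | e p q]|]; last first.
  (* If every [p] misses the bound by at least one, summing over the nonempty [P] contradicts the
     double count of related pairs, because [#|P| <= c * d]. *)
  have: \sum_(p in P) c * #|[set q in Q | e p q]| + #|P| <= #|P| * #|Q|.
    rewrite -sum_nat_const -[X in _ + X]sum1_card -big_split /=.
    apply: leq_sum => p pP; rewrite addn1 ltnNge.
    by apply: contra no_p => ?; apply/exists_inP; exists p.
  rewrite -big_distrr /= sum_degreesC.
  have : #|Q| * d <= \sum_(q in Q) #|[set p in P | e p q]|.
    by rewrite -sum_nat_const; exact: leq_sum.
  move: (\sum_(q in Q) _) => D QdD.
  have : c * (#|Q| * d) <= c * D by rewrite leq_mul2l QdD orbT.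
  have : #|P| * #|Q| <= c * d * #|Q|.
    rewrite leq_mul2r (leq_trans Pcd) ?orbT //.
    by rewrite leq_mul2l leq_subr orbT.
  by lia.
have cP1 : #|P| = #|P :\ p|.+1 by rewrite (cardsD1 p) pP.
have [||q|S [Q' [sSP sQ' cS cQ' jSQ']]] :=
    IHs d.-1 (P :\ p) [set q in Q | e p q].
- by lia.
- by move: Pcd; rewrite cP1 -subn1 -subnDA add1n => /ltnW.
- rewrite inE => /andP[qQ epq]; have := degQ q qQ.
  have -> : [set x in P :\ p | e x q] = [set x in P | e x q] :\ p.
    by apply/setP => x; rewrite !inE andbA.
  by rewrite (cardsD1 p [set x in P | e x q]) !inE pP epq; lia.
have sub_nbrs : [set q in Q | e p q] \subset Q.
  by apply/subsetP => x; rewrite inE => /andP[].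
exists (p |: S), Q'; split.
- by rewrite subUset sub1set pP (subset_trans sSP) // subsetDl.
- exact: subset_trans sQ' sub_nbrs.
- rewrite cardsU1 cS; case: (boolP (p \in S)) => // /(subsetP sSP).
  by rewrite !inE eqxx.
- by rewrite (leq_trans Qp) // expnS -mulnA leq_mul2l cQ' orbT.
- move=> x y /setU1P[->|xS] yQ'; last exact: jSQ'.
  by have := subsetP sQ' _ yQ'; rewrite inE => /andP[].
Qed.

(** An average degree above [n / 5] forces at least [n / 10] vertices of degree at least [n %/ 10],
    since the remaining ones contribute at most [n * (n %/ 10)]. Common neighbours are then
    extracted from these vertices. *)
Lemma dense_joined e s P :
    20 * s + 18 <= #|P| -> 10 * s * 20 ^ s <= #|P| ->
    #|P| ^ 2 < 5 * \sum_(q in P) #|[set p in P | e p q]| ->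
  exists A B, [/\ s <= #|A|, s <= #|B| & joined e A B].
Proof.
move=> n_large1 n_large2 dense; set n := #|P| in n_large1 n_large2 dense.
set deg := fun q => #|[set p in P | e p q]|.
pose Q := [set q in P | n %/ 10 <= deg q].
have deg_ub q : deg q <= n.
  by apply: subset_leq_card; apply/subsetP => x; rewrite inE => /andP[].
have cQ : n <= 10 * #|Q|.
  have : \sum_(q in P) deg q <= #|Q| * n + n * (n %/ 10).
    rewrite (bigID (fun q => n %/ 10 <= deg q)) /=; apply: leq_add.
      have -> : #|Q| * n = \sum_(q in P | n %/ 10 <= deg q) n.
        by rewrite -sum_nat_const; apply: eq_bigl => q; rewrite inE.
      by apply: leq_sum => q _; exact: deg_ub.
    rewrite -[n in n * _]/(#|P|) -sum_nat_const.
    rewrite [leqRHS](bigID (fun q => n %/ 10 <= deg q)) /=.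
    rewrite -[leqLHS]add0n leq_add // leq_sum // => q /andP[_].
    by rewrite -ltnNge => /ltnW.
  move: dense; rewrite -/(\sum_(q in P) deg q); move: (\sum_(q in P) deg q) => D.
  rewrite leqNgt => dense le_D; apply/negP => ltQ.
  nia.
(* The factor 20 works because [20 * (n %/ 10) >= 2 * n - 18], which is at least [n + 20 * s] by the
   first bound on [n]. *)
have [||q|A [B [_ _ cA cB jAB]]] := @common_neighbours e 20 s (n %/ 10) P Q.
- by rewrite -/n; lia.
- by rewrite -/n; lia.
- by rewrite inE => /andP[].
exists A, B; split; rewrite ?cA //.
have : 10 * s * 20 ^ s <= 10 * (20 ^ s * #|B|) by lia.
by rewrite -mulnA [s * _]mulnC leq_mul2l /= leq_mul2l; have := expn_gt0 20 s; lia.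
Qed.

(** Cut [P] down to [4 * t] vertices. Every [q] in [Q] sees at least half of them in one color, and
    one of the two resulting classes of [Q] has at least [t * 4 ^ t] vertices. The bound
    [4 * t <= 4 * (2 * t - t)] is just what [common_neighbours] requires with [c = 4]. *)
Lemma bipartite_ramsey r b t P Q :
    0 < t -> joined (fun x y => r x y || b x y) P Q ->
    4 * t <= #|P| -> 2 * t * 4 ^ t <= #|Q| ->
  exists A B, [/\ A \subset P, B \subset Q, t <= #|A|, t <= #|B|
                & joined r A B \/ joined b A B].
Proof.
move=> t_gt0 total /subset_of_card[P' sP' cP'] cQ.
have [cl cl_r cl_b] : exists2 cl : pred T,
    {in Q, forall q, cl q -> 2 * t <= #|[set p in P' | r p q]|} &
    {in Q, forall q, ~~ cl q -> 2 * t <= #|[set p in P' | b p q]|}.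
  exists (fun q => 2 * t <= #|[set p in P' | r p q]|) => // q qQ.
  rewrite -ltnNge => lt_r.
  have : #|P'| <= #|[set p in P' | r p q]| + #|[set p in P' | b p q]|.
    rewrite (leq_trans _ (leq_card_setU _ _)) ?subset_leq_card //.
    apply/subsetP => p pP'; rewrite !inE pP' /=.
    exact: total (subsetP sP' _ pP') qQ.
  by lia.
have sQ c : [set q in Q | c q] \subset Q.
  by apply/subsetP => x; rewrite inE => /andP[].
have main e (Q1 : {set T}) : Q1 \subset Q -> t * 4 ^ t <= #|Q1| ->
    {in Q1, forall q, 2 * t <= #|[set p in P' | e p q]|} ->
    exists A B, [/\ A \subset P, B \subset Q, t <= #|A|, t <= #|B| & joined e A B].
  move=> sQ1 cQ1 degQ1.
  have [||A [B [sA sB cA cB jAB]]] := common_neighbours (c := 4) (s := t) _ _ degQ1.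
  - by lia.
  - by lia.
  exists A, B; split; rewrite ?cA ?(subset_trans sA) ?(subset_trans sB) //.
  have := leq_trans cQ1 cB.
  by rewrite mulnC leq_mul2l; have := expn_gt0 4 t; lia.
have cQs : #|Q| = #|[set q in Q | cl q]| + #|[set q in Q | ~~ cl q]|.
  rewrite -(cardsID [set q | cl q] Q); congr (_ + _); apply: eq_card => q.
    by rewrite !inE.
  by rewrite !inE andbC.
have [le1|gt1] := leqP (t * 4 ^ t) #|[set q in Q | cl q]|.
  have [q|A [B [sA sB cA cB jAB]]] := main r _ (sQ _) le1.
    by rewrite inE => /andP[]; exact: cl_r.
  by exists A, B; split=> //; left.
have le2 : t * 4 ^ t <= #|[set q in Q | ~~ cl q]| by lia.
have [q|A [B [sA sB cA cB jAB]]] := main b _ (sQ (predC cl)) le2.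
  by rewrite inE => /andP[]; exact: cl_b.
by exists A, B; split=> //; right.
Qed.
End Ramsey.

(** The usual induction on [i + j] through the two neighbourhoods of a vertex [v]. [N] is uniform in
    [T], so it can be fixed before the order of the complete graph. *)
Lemma ramsey i j : exists N, forall (T : finType) (r b : rel T) (S : {set T}),
    symmetric r -> symmetric b -> clique (fun x y => r x y || b x y) S ->
    N <= #|S| ->
  exists2 A : {set T}, A \subset S &
    (clique r A /\ i <= #|A|) \/ (clique b A /\ j <= #|A|).
Proof.
have [k] := ubnP (i + j); elim: k i j => // k IHk [|i] j lt_k.
  exists 0 => T r b S _ _ _ _; exists set0; first exact: sub0set.
  by left; split=> // x y; rewrite inE.
case: j lt_k => [|j] lt_k.
  exists 0 => T r b S _ _ _ _; exists set0; first exact: sub0set.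
  by right; split=> // x y; rewrite inE.
have [|N1 ram1] := IHk i j.+1; first by lia.
have [|N2 ram2] := IHk i.+1 j; first by lia.
exists (N1 + N2).+1 => T r b S sr sb total cS.
have /card_gt0P[v vS] : 0 < #|S| by lia.
pose Sr := [set x in S :\ v | r v x]; pose Sb := [set x in S :\ v | b v x].
have sSr : Sr \subset S by apply/subsetP => x; rewrite !inE => /andP[/andP[]].
have sSb : Sb \subset S by apply/subsetP => x; rewrite !inE => /andP[/andP[]].
have v_r : v \notin Sr by rewrite !inE eqxx.
have v_b : v \notin Sb by rewrite !inE eqxx.
have cSv : #|S| <= #|Sr| + #|Sb| + 1.
  have : #|S :\ v| <= #|Sr| + #|Sb|.
    rewrite (leq_trans _ (leq_card_setU _ _)) ?subset_leq_card //.
    apply/subsetP => x; rewrite !inE => /andP[xv xS]; rewrite xv xS /=.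
    by apply: total => //; rewrite eq_sym.
  by rewrite (cardsD1 v S) vS; lia.
have [le1|gt1] := leqP N1 #|Sr|.
  have [A sA [[cliA cA]|[cliA cA]]] := ram1 _ r b Sr sr sb (sub_clique sSr total) le1.
    exists (v |: A); first by rewrite subUset sub1set vS (subset_trans sA).
    left; split; last first.
      by rewrite cardsU1 (contraNN (subsetP sA v) v_r).
    apply: clique_setU1 => // y /(subsetP sA).
    by rewrite inE => /andP[].
  by exists A; [exact: subset_trans sA sSr | right].
have le2 : N2 <= #|Sb| by lia.
have [A sA [[cliA cA]|[cliA cA]]] := ram2 _ r b Sb sr sb (sub_clique sSb total) le2.
  by exists A; [exact: subset_trans sA sSb | left].
exists (v |: A); first by rewrite subUset sub1set vS (subset_trans sA).
right; split; last by rewrite cardsU1 (contraNN (subsetP sA v) v_b).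
apply: clique_setU1 => // y /(subsetP sA).
by rewrite inE => /andP[].
Qed.

(** * Two-colorings of complete graphs and their unavoidable patterns *)

Section Colorings.
Variable n : nat.
Implicit Types (R B : {set {set 'I_n}}) (A C : {set 'I_n}).

Definition adj R : rel 'I_n := fun x y => [set x; y] \in R.

Lemma adj_sym R : symmetric (adj R).
Proof. by move=> x y; rewrite /adj setUC. Qed.

(** On the union of [A] and [C], the color [R] is either a clique on [A] and nothing else, or the
    complete bipartite graph between [A] and [C]. The patterns with the colors exchanged are
    [pattern t B R]. *)
Definition pattern t R B := exists A C : {set 'I_n},
  [/\ [disjoint A & C], t <= #|A|, t <= #|C| &
      [/\ clique (adj R) A, clique (adj B) C & joined (adj B) A C] \/
      [/\ clique (adj B) A, clique (adj B) C & joined (adj R) A C]].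

Lemma two_coloringC R B : two_coloring R B = two_coloring B R.
Proof. by rewrite /two_coloring /bipartition setUC disjoint_sym. Qed.

Lemma two_coloring_total R B x y :
  two_coloring R B -> x != y -> adj R x y || adj B x y.
Proof.
by case/andP => /eqP RB _ xy; rewrite -in_setU RB inE cards2 xy.
Qed.

Lemma two_coloring_adjN R B x y :
  two_coloring R B -> adj R x y -> ~~ adj B x y.
Proof. by case/andP => _ /disjointFr dRB /dRB; rewrite /adj => ->. Qed.

Lemma two_coloring_irr R B x : two_coloring R B -> ~~ adj R x x.
Proof.
case/andP => /eqP RB _; apply/negP => xR.
have : [set x; x] \in R :|: B by rewrite inE [_ \in R]xR.
by rewrite RB inE cards2 eqxx.
Qed.

Lemma joined_disjoint R B A C :
  two_coloring R B -> joined (adj R) A C -> [disjoint A & C].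
Proof.
move=> col jAC; apply/pred0P => x /=; apply/negP => /andP[xA xC].
by have := two_coloring_irr x col; rewrite jAC.
Qed.

(** Cliques of different colors share at most one vertex; the strict bound on [#|C|] pays for
    deleting it. Bipartite Ramsey then makes the pairs between them monochromatic, and the clique of
    that same color becomes the second set of the pattern. *)
Lemma two_cliques_pattern R B t A C :
    two_coloring R B -> 0 < t ->
    clique (adj R) A -> clique (adj B) C ->
    4 * t <= #|A| -> 2 * t * 4 ^ t < #|C| ->
  pattern t R B \/ pattern t B R.
Proof.
move=> col t0 cliA cliC cA cC.
have cI : #|A :&: C| <= 1.
  apply/card_le1_eqP => y x /setIP[yA yC] /setIP[xA xC].
  apply/eqP/negPn/negP => xy; have := two_coloring_adjN col (cliA _ _ xA yA xy).
  by rewrite cliC.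
have dAC : [disjoint A & C :\: A] by rewrite -setI_eq0 setIDA setIC setDIl setDv setI0.
have [||A' [C' [sA sC cA' cC' H]]] :=
    @bipartite_ramsey _ (adj R) (adj B) t A (C :\: A) t0 _ cA.
- move=> x y xA yC; apply: two_coloring_total col _.
  by apply: contraTneq yC => <-; rewrite inE xA.
- by rewrite -ltnS (leq_trans cC) // -(cardsID A C) [C :&: A]setIC -add1n leq_add2r.
have {}sC' := subset_trans sC (subsetDl C A).
have dA'C' : [disjoint A' & C'] := disjointWl sA (disjointWr sC dAC).
case: H => jAC; [right | left].
  exists C', A'; split; rewrite 1?disjoint_sym //.
  left; split; [exact: sub_clique cliC | exact: sub_clique cliA |].
  by move=> x y xC yA; rewrite adj_sym; exact: jAC.
exists A', C'; split=> //.
by left; split; [exact: sub_clique cliA | exact: sub_clique cliC |].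
Qed.

Lemma dense_color_joined R s :
    20 * s + 18 <= n -> 10 * s * 20 ^ s <= n -> n ^ 2 < 5 * #|R| ->
    R \subset complete_edges n ->
  exists A C, [/\ s <= #|A|, s <= #|C| & joined (adj R) A C].
Proof.
move=> n1 n2 dense sR.
have [|||A [C [cA cC jAC]]] := @dense_joined _ (adj R) s setT.
- by rewrite cardsT card_ord.
- by rewrite cardsT card_ord.
- rewrite cardsT card_ord (leq_trans dense) // leq_mul2l /=.
  under eq_bigr => q _ do rewrite -sum1dep_card.
  rewrite pair_big_dep /= sum1dep_card.
  (* Every edge of [R] is the image of an adjacent ordered pair, so the degree sum is at least
     [#|R|]. *)
  rewrite (leq_trans _ (leq_imset_card (fun p => [set p.1; p.2]) _)) //.
  rewrite subset_leq_card //; apply/subsetP => e eR.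
  have := subsetP sR _ eR; rewrite inE => /cards2P[x [y [xy ex]]].
  apply/imsetP; exists (x, y) => //; rewrite !inE /= adj_sym.
  by rewrite /adj -ex.
by exists A, C.
Qed.
End Colorings.

(** The factor 5 leaves room below balanced colorings, where each color has about [n ^ 2 / 4]
    edges. *)
Lemma unavoidable_patterns t : exists N, forall n (R B : {set {set 'I_n}}),
    N <= n -> two_coloring R B -> n ^ 2 < 5 * minn #|R| #|B| ->
  pattern t R B \/ pattern t B R.
Proof.
wlog t0 : t / 0 < t.
  case: t => [_|t]; last by exact.
  by exists 0 => n R B _ _ _; left; exists set0, set0; split;
     rewrite ?cards0 // ?disjoints0 ?disjoints_subset ?sub0set //; left; split => x y; rewrite inE.
(* The size that [two_cliques_pattern] asks of its second clique; it also covers the [4 * t] asked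
   of the first. *)
pose m := (2 * t * 4 ^ t).+1.
have m4 : 4 * t <= m.
  by case: (t) t0 @m => // t' _; rewrite expnS; have := expn_gt0 4 t'; nia.
have [s ram] := ramsey t m.
pose N := 20 * s + 18 + 10 * s * 20 ^ s.
(* Density of [B] gives two large sets joined in [B]. If both contain an [R]-clique of size [t],
   they form a bipartite pattern; otherwise there is a [B]-clique of size [m]. Using this for each
   color leaves only the case of two large cliques. *)
have step n (R B : {set {set 'I_n}}) : N <= n -> two_coloring R B ->
    n ^ 2 < 5 * #|B| ->
    pattern t B R \/ exists2 D : {set 'I_n}, clique (adj B) D & m <= #|D|.
  move=> nN col dense.
  have sB : B \subset complete_edges n.
    rewrite -[complete_edges n]/(edges (complete_graph n)).
    by case/andP: col => /eqP <- _; exact: subsetUr.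
  have [||A [C [cA cC jAC]]] := dense_color_joined (s := s) _ _ dense sB.
  - by lia.
  - by lia.
  have inside (D : {set 'I_n}) : s <= #|D| ->
      exists2 D' : {set 'I_n}, D' \subset D &
        clique (adj R) D' /\ t <= #|D'| \/ clique (adj B) D' /\ m <= #|D'|.
    apply: ram; [exact: adj_sym | exact: adj_sym |].
    by move=> x y _ _; exact: two_coloring_total.
  have [A' sA [[cliA cA']|[cliA cA']]] := inside A cA; last by right; exists A'.
  have [C' sC [[cliC cC']|[cliC cC']]] := inside C cC; last by right; exists C'.
  have jAC' := sub_joined sA sC jAC.
  left; exists A', C'; split=> //; last by right.
  by apply: joined_disjoint jAC'; rewrite two_coloringC; exact: col.
exists N => n R B nN col dense.
have colC : two_coloring B R by rewrite two_coloringC.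
have [|?|[C cliC cC]] := step n R B nN col; first by nia.
  by right.
have [|?|[A cliA cA]] := step n B R nN colC; first by nia.
  by left.
by apply: two_cliques_pattern col t0 cliA cliC (leq_trans m4 cA) cC.
Qed.

Lemma double_bin2 n : 2 * 'C(n, 2) = n * n.-1.
Proof. by rewrite mulnC (bin_ffact n 2) ffactnS ffactn1. Qed.

(** * Colored copies of [G] as injections of its vertices *)

Section Copies.
Variable G : sgraph.
Implicit Types (X Y W : {set G}) (n : nat).

Lemma in_bipartition X Y x :
  bipartition [set: G] X Y -> (x \in Y) = (x \notin X).
Proof.
case/andP => /eqP XY dXY; have := in_setT x; rewrite -XY inE.
by case: (boolP (x \in X)) => [xX _ | _ /= ->]; rewrite ?(disjointFr dXY xX).
Qed.

(** Crossing is expressed by inclusions alone, a form that passes through preimages under an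
    embedding. *)
Lemma mem_cut_edges X Y e :
  bipartition [set: G] X Y -> e \in edges G ->
  (e \in cut_edges X Y) = ~~ (e \subset X) && ~~ (e \subset Y).
Proof.
move=> XY eG; have memY x := in_bipartition x XY; rewrite inE eG /=.
have /eqP/cards2P[x [y [_ ->]]] := edges_card2 eG.
rewrite !subUset !sub1set !memY.
apply/exists_inP/idP => [[a aX /exists_inP[b]] | ].
  rewrite memY => bX /eqP E.
  have aE : a \in [set x; y] by rewrite E set21.
  have bE : b \in [set x; y] by rewrite E set22.
  by case/set2P: aE bE aX bX => -> /set2P[] -> -> //; case: (_ \in _).
have [xX|xX] := boolP (x \in X) => /= yX.
  by exists x => //; apply/exists_inP; exists y; rewrite ?memY //; case: (y \in X) yX.
exists y; first by case: (y \in X) yX.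
by apply/exists_inP; exists x; rewrite ?memY // setUC.
Qed.

Definition pulled_edges n (R : {set {set 'I_n}}) (phi : G -> 'I_n) :=
  [set e in edges G | phi @: (e : {set G}) \in R].

Lemma imset_edge n (phi : G -> 'I_n) e :
  injective phi -> e \in edges G -> #|phi @: (e : {set G})| == 2.
Proof. by move=> inj eG; rewrite card_imset // edges_card2. Qed.

Lemma card_pulled_edges n (R : {set {set 'I_n}}) (phi : G -> 'I_n) :
  injective phi ->
  #|[set phi @: (e : {set G}) | e in edges G] :&: R| = #|pulled_edges R phi|.
Proof.
move=> inj; rewrite -(card_imset _ (imset_inj inj)); apply: eq_card => f.
apply/setIP/imsetP => [[/imsetP[e eG ->] eR] | [e]].
  by exists e; rewrite // inE eG.
by rewrite inE => /andP[eG eR] ->; split=> //; exact: imset_f.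
Qed.

Lemma card_pulled_edgesC n (R B : {set {set 'I_n}}) (phi : G -> 'I_n) :
  two_coloring R B -> injective phi ->
  #|pulled_edges R phi| + #|pulled_edges B phi| = num_edges G.
Proof.
case/andP => /eqP RB dRB inj.
rewrite /num_edges -(cardsID [set e : {set G} | phi @: e \in R] (edges G)).
congr (_ + _); apply: eq_card => e; rewrite !inE //.
have [eG /=|_] := boolP (e \in edges G); last by rewrite andbF.
rewrite andbT.
have : phi @: e \in R :|: B by rewrite RB inE imset_edge.
rewrite inE; have [eR _|//] := boolP (_ \in R).
by rewrite (disjointFr dRB).
Qed.

(** In a complete graph every injection of the vertices yields a copy, and the number of red edges
    determines the number of blue ones. Counting thus moves from the copy back to the edges of
    [G]. *)
Lemma colored_copyP n (R B : {set {set 'I_n}}) r b :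
    two_coloring R B -> r + b = num_edges G ->
  reflect (exists2 phi : G -> 'I_n, injective phi & #|pulled_edges R phi| = r)
          (has_colored_copy G R B r b).
Proof.
move=> col rb; apply: (iffP existsP) => [[U /existsP[F]] | [phi inj cR]].
  case/and4P => _ /existsP[phi /and3P[/injectiveP inj _ /eqP <-]] /eqP cR _.
  by exists phi; rewrite // -card_pulled_edges.
pose f := [ffun x => phi x].
have fE : f =1 phi by move=> x; rewrite ffunE.
have injf : injective f by move=> x y; rewrite !fE => /inj.
have cRf : #|pulled_edges R f| = r.
  by rewrite -cR; apply: eq_card => e; rewrite !inE (eq_imset _ fE).
exists (f @: [set: G]); apply/existsP.
exists [set f @: (e : {set G}) | e in edges G]; apply/and4P; split.
- apply/andP; split.
    by apply/subsetP => _ /imsetP[e eG ->]; rewrite inE imset_edge.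
  by apply/forall_inP => _ /imsetP[e eG ->]; rewrite imsetS // subsetT.
- by apply/existsP; exists f; apply/and3P; split=> //; exact/injectiveP.
- by rewrite card_pulled_edges ?cRf.
- rewrite card_pulled_edges //; have := card_pulled_edgesC col injf.
  by rewrite cRf -rb => /addnI ->.
Qed.

Lemma colored_copyC n (R B : {set {set 'I_n}}) r b :
  has_colored_copy G R B r b = has_colored_copy G B R b r.
Proof.
apply: eq_existsb => U; apply: eq_existsb => F.
by congr (_ && (_ && _)); rewrite andbC.
Qed.

Lemma injection_into (T : finType) (A : {set T}) :
  #|G| <= #|A| -> exists2 f : G -> T, injective f & forall x, f x \in A.
Proof.
move=> cA; have lt x : enum_rank x < #|A| := leq_trans (ltn_ord _) cA.
exists (fun x => enum_val (Ordinal (lt x))); last by move=> x; exact: enum_valP.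
move=> x y /enum_val_inj/(congr1 val)/= E.
by apply: enum_rank_inj; exact: val_inj.
Qed.

Lemma injection_split (T : finType) (A C : {set T}) W :
    [disjoint A & C] -> #|G| <= #|A| -> #|G| <= #|C| ->
  exists2 f : G -> T, injective f & forall x, f x \in if x \in W then A else C.
Proof.
move=> dAC /injection_into[f1 inj1 f1A] /injection_into[f2 inj2 f2C].
have ne x y : f1 x <> f2 y.
  by move=> E; have := disjointFr dAC (f1A x); rewrite E f2C.
exists (fun x => if x \in W then f1 x else f2 x); last first.
  by move=> x; case: ifP.
move=> x y; case: ifP => _; case: ifP => _; first exact: inj1.
- by move/ne.
- by move/esym/ne.
- exact: inj2.
Qed.

(** For a clique pattern, send [W] into [A] and the rest into [C]: the red edges are those induced
    by [W]. For a bipartite pattern, do the same with [X]: the red edges are those of the cut. *)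
Lemma pattern_copies n (R B : {set {set 'I_n}}) r b :
    (forall r, r <= num_edges G ->
       (exists X Y : {set G},
          bipartition [set: G] X Y /\ #|cut_edges X Y| = r) /\
       (exists W : {set G}, #|induced_edges W| = r)) ->
    two_coloring R B -> pattern #|G| R B -> r + b = num_edges G ->
  has_colored_copy G R B r b.
Proof.
move=> hG col [A [C [dAC cA cC pat]]] rb; apply/(colored_copyP col rb).
have [|[X [Y [XY cXY]]] [W cW]] := hG r; first by rewrite -rb leq_addr.
have notR x y : adj B x y -> ([set x; y] \in R) = false.
  by move=> bxy; apply/negbTE; apply: contraL bxy; exact: two_coloring_adjN.
case: pat => [[cliA cliC jAC] | [cliA cliC jAC]].
  have [phi inj phiAC] := injection_split W dAC cA cC.
  exists phi => //; rewrite -cW; apply: eq_card => e; rewrite !inE.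
  have [eG|//] := boolP (e \in edges G).
  have /eqP/cards2P[x [y [xy ->]]] := edges_card2 eG.
  rewrite imsetU1 imset_set1 subUset !sub1set /=.
  have pxy : phi x != phi y by rewrite (inj_eq inj).
  have := phiAC x; have := phiAC y.
  case: ifP => yW; case: ifP => xW yP xP /=.
  - exact: cliA.
  - by rewrite notR // adj_sym; exact: jAC.
  - by rewrite notR //; exact: jAC.
  - by rewrite notR //; exact: cliC.
have [phi inj phiAC] := injection_split X dAC cA cC.
exists phi => //; rewrite -cXY; apply: eq_card => e; rewrite [LHS]inE.
have [eG|] := boolP (e \in edges G); last by rewrite inE => /negbTE->.
rewrite mem_cut_edges //.
have /eqP/cards2P[x [y [xy ->]]] := edges_card2 eG.
rewrite imsetU1 imset_set1 !subUset !sub1set !(in_bipartition _ XY) /=.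
have pxy : phi x != phi y by rewrite (inj_eq inj).
have := phiAC x; have := phiAC y.
case: ifP => yX; case: ifP => xX yP xP /=.
- by rewrite notR //; exact: cliA.
- by rewrite setUC; exact: jAC.
- exact: jAC.
- by rewrite notR //; exact: cliC.
Qed.
End Copies.


(** * Omnitonality in terms of balanced colorings *)

Lemma card_two_coloring n (R B : {set {set 'I_n}}) :
  two_coloring R B -> #|R| + #|B| = 'C(n, 2).
Proof.
case/andP => /eqP RB dRB; have [_] := leq_card_setU R B.
rewrite dRB RB => /eqP <-; rewrite -[in RHS](card_ord n) -card_draws.
by apply: eq_card => e; rewrite !inE.
Qed.

Lemma two_coloring_complement n (R : {set {set 'I_n}}) :
  R \subset complete_edges n -> two_coloring R (complete_edges n :\: R).
Proof.
move=> sR; apply/andP; split; last first.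
  by rewrite -setI_eq0 setIDA setIC setDIl setDv setI0.
by rewrite -[edges _]/(complete_edges n) -[X in _ == X](setID _ R) (setIidPr sR).
Qed.

(** With exactly half of the edges in each color, both classes exceed [ot n G], so admissibility of
    this value supplies the copies. *)
Lemma omnitonal_balanced G : omnitonal G ->
  exists N, forall n (R B : {set {set 'I_n}}) r b, N <= n ->
    two_coloring R B -> 2 * #|R| = 'C(n, 2) -> r + b = num_edges G ->
  has_colored_copy G R B r b.
Proof.
case=> N omn; exists N => n R B r b nN col cR rb; have := omn n nN.
rewrite /ot; case: ex_minnP => s adm _ lt_s.
have cB := card_two_coloring col.
have ltr : r < (num_edges G).+1 by lia.
have ltb : b < (num_edges G).+1 by lia.
move: adm => /forallP/(_ R)/forallP/(_ B)/implyP/(_ col)/implyP.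
have -> : s < minn #|R| #|B| by lia.
move=> /(_ isT)/forallP/(_ (Ordinal ltr))/forallP/(_ (Ordinal ltb))/implyP.
by apply; rewrite /= rb.
Qed.

Lemma omnitonal_of_balanced G N :
    (forall n (R B : {set {set 'I_n}}) r b, N <= n ->
       two_coloring R B -> n ^ 2 < 5 * minn #|R| #|B| ->
       r + b = num_edges G -> has_colored_copy G R B r b) ->
  omnitonal G.
Proof.
(* For [n >= 40] half of the edges, rounded down, is positive and more than [n ^ 2 / 5]; its
   predecessor is shown to be admissible. *)
move=> copies; exists (N + 40) => n nN.
have n2 := double_bin2 n.
have h0 : 0 < 'C(n, 2)./2 by nia.
rewrite /ot; case: ex_minnP => s _ min_s.
suff /min_s : ot_admissible n G ('C(n, 2)./2).-1 by lia.
apply/forallP => R; apply/forallP => B; apply/implyP => col; apply/implyP => lt.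
apply/forallP => r; apply/forallP => b; apply/implyP => /eqP rb.
by apply: copies => //; nia.
Qed.

(** * Balanced cliques and cuts, and the characterization of omnitonal graphs *)

Lemma edges_inside_sub n (K : {set 'I_n}) :
  [set e : {set 'I_n} | e \subset K & #|e| == 2] \subset complete_edges n.
Proof. by apply/subsetP => e; rewrite !inE => /andP[]. Qed.

Lemma subset_of_ord n k : k <= n -> exists K : {set 'I_n}, #|K| = k.
Proof.
move=> kn; have [|K _ cK] := @subset_of_card 'I_n [set: 'I_n] k.
  by rewrite cardsT card_ord.
by exists K.
Qed.

(* The solutions of the Pell equation [x ^ 2 - 2 * y ^ 2 = -1], where [x = 2 * n - 1] and
   [y = 2 * k - 1], are generated from [(1, 1)] by [(x, y) |-> (3 * x + 4 * y, 2 * x + 3 * y)]. *)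
Lemma balanced_clique_sizes N :
  exists n k, [/\ N <= n, k <= n & 2 * 'C(k, 2) = 'C(n, 2)].
Proof.
suff [n [k [Nn k0 kn E]]] :
    exists n k, [/\ N < n, 0 < k, k <= n & 2 * (k * k.-1) = n * n.-1].
  exists n, k; split=> //; first exact: ltnW.
  by have := double_bin2 n; have := double_bin2 k; lia.
elim: N => [|N [n [k [Nn k0 kn E]]]]; first by exists 1, 1.
exists (3 * n + 4 * k - 3), (2 * n + 3 * k - 2); split; [lia | lia | lia |].
case: n k Nn k0 kn E => // n [|k] // _ _ _ E.
have -> : 3 * n.+1 + 4 * k.+1 - 3 = (3 * n + 4 * k + 3).+1 by lia.
have -> : 2 * n.+1 + 3 * k.+1 - 2 = (2 * n + 3 * k + 2).+1 by lia.
by move: E => /=; lia.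
Qed.

(* A cut [(k, n - k)] contains half of the edges of [K_n] exactly when [(n - 2 * k) ^ 2 = n]. *)
Lemma balanced_cut_sizes m :
  'C(m, 2) <= m ^ 2 /\
  2 * ('C('C(m, 2), 2) + 'C(m ^ 2 - 'C(m, 2), 2)) = 'C(m ^ 2, 2).
Proof.
(* With [n = m ^ 2] and [k = 'C(m, 2)] one has [n - 2 * k = m], so the parts have sizes [k] and
   [k + m]. *)
have m2 := double_bin2 m; set k := 'C(m, 2) in m2 *; rewrite -mulnn.
have predK x : x * x.-1 + x = x * x by case: x => // x; rewrite -mulnSr.
have mm : m * m = 2 * k + m by rewrite m2 predK.
have kn : k <= m * m by lia.
have l_eq : m * m - k = k + m by lia.
rewrite /= l_eq; split=> //.
have := predK k; have := predK (k + m); have := predK (m * m).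
rewrite -!double_bin2 mm.
by move: ('C(k, 2)) ('C(k + m, 2)) ('C(2 * k + m, 2)) => a b c; lia.
Qed.

Theorem theorem2p6 (G : sgraph) :
  omnitonal G <->
  (forall r : nat, r <= num_edges G ->
     (exists X Y : {set G},
        bipartition [set: G] X Y /\ #|cut_edges X Y| = r) /\
     (exists W : {set G}, #|induced_edges W| = r)).
Proof.
split=> [/omnitonal_balanced[N copies] r le_r | hG]; last first.
  have [N patterns] := unavoidable_patterns #|G|.
  apply: (@omnitonal_of_balanced _ N) => n R B r b nN col dense rb.
  have [pat | pat] := patterns n R B nN col dense.
    exact: pattern_copies pat rb.
  (* Exchanging the colors also exchanges [r] and [b], so here the hypothesis on [G] is used for
     [b]. *)
  by rewrite colored_copyC; apply: pattern_copies pat _;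
     rewrite // 1?two_coloringC // addnC.
have rb : r + (num_edges G - r) = num_edges G by rewrite subnKC.
split.
  have [kn E] := balanced_cut_sizes N; have [K cK] := subset_of_ord kn.
  set n := N ^ 2 in kn K cK E.
  pose mono (A : {set 'I_n}) := [set e : {set 'I_n} | e \subset A & #|e| == 2].
  (* The first color consists of the edges inside [K] or its complement, so the cut is the second
     color. Hence a copy with [r] edges of the second color is requested and the colors are swapped
     afterwards. *)
  have sB : mono K :|: mono (~: K) \subset complete_edges n.
    by rewrite subUset !edges_inside_sub.
  have col := two_coloring_complement sB.
  have dI : [disjoint mono K & mono (~: K)].
    apply/pred0P => e; rewrite !inE; apply/negP => /andP[/andP[eK /eqP c2] /andP[eK' _]].
    have : e \subset set0 by rewrite -(setICr K) subsetI eK.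
    by rewrite subset0 => /eqP e0; rewrite e0 cards0 in c2.
  have cB : 2 * #|mono K :|: mono (~: K)| = 'C(n, 2).
    have [_] := leq_card_setU (mono K) (mono (~: K)); rewrite dI => /eqP ->.
    by rewrite !cards_draws [#|~: K|]cardsCs setCK card_ord cK.
  have nN : N <= n by rewrite /n; case: (N) => // N'; rewrite -mulnn leq_pmulr.
  have := copies n _ _ (num_edges G - r) r nN col cB; rewrite subnK // => /(_ erefl).
  rewrite colored_copyC => /(colored_copyP _ rb)[|phi inj cphi]; first by rewrite two_coloringC.
  have XY : bipartition [set: G] (phi @^-1: K) (~: (phi @^-1: K)).
    by rewrite /bipartition setUCr eqxx -setI_eq0 setICr eqxx.
  exists (phi @^-1: K), (~: (phi @^-1: K)); split=> //.
  rewrite -cphi; apply: eq_card => e; rewrite [RHS]inE.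
  have [eG|] := boolP (e \in edges G); last by rewrite inE => /negbTE->.
  rewrite mem_cut_edges // 4!inE imset_edge // -preimsetC !sub_imset_pre !andbT.
  by rewrite [_ \in complete_edges _]inE imset_edge // negb_or andbT.
(* Now the first color is a clique on [K]; in a copy with [r] edges of this color they are the edges
   induced by the preimage of [K]. *)
have [n [k [nN kn E]]] := balanced_clique_sizes N; have [K cK] := subset_of_ord kn.
have col := two_coloring_complement (edges_inside_sub K).
have := copies n _ _ r _ nN col _ rb; rewrite cards_draws cK => /(_ E).
move=> /(colored_copyP col rb)[phi inj <-]; exists (phi @^-1: K).
apply: eq_card => e; rewrite !inE; have [eG|//] := boolP (e \in edges G).
by rewrite imset_edge // sub_imset_pre andbT.
Qed.
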